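(* Let $I\subseteq\mathbb{R}$ be an interval and let $F:I\rightrightarrows\mathbb{R}$ be a lower semicontinuous set-valued function (with nonempty values). Let $J\subseteq I$ be dense in $I$ and assume that $F$ is locally strictly pseudomonotone on $J$. Assume further that $0\notin F(x)$ for all $x\in I\setminus J$. Then $F$ is strictly pseudomonotone on $I$.
   Context: A set-valued function $F:I\rightrightarrows\mathbb{R}$ assigns to each $x\in I$ a nonempty set $F(x)\subseteq\mathbb{R}$. A set $J\subseteq I$ is dense in $I$ if $I\subseteq \mathrm{cl}(J)$. $F$ is lower semicontinuous if for every $x\in I$ and every open $N\subseteq\mathbb{R}$ with $F(x)\cap N\neq\emptyset$ there is a neighborhood $M$ of $x$ such that $F(y)\cap N\neq\emptyset$ for all $y\in M\cap I$. Strictly pseudomonotone (on $A\subseteq I$): for all $x,y\in A$ with $x\neq y$, $x^*\in F(x)$, $y^*\in F(y)$: $x^*(y-x)\ge0\Rightarrow y^*(y-x)>0$. $F$ is locally strictly pseudomonotone on $J$ if every $x\in J$ has an open neighborhood $U_x$ such that $F$ is strictly pseudomonotone on $U_x\cap J$. *)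

(* Defs.v *)
From mathcomp Require Import all_boot all_order all_algebra.
From mathcomp Require Import all_classical all_reals all_analysis.

Set Implicit Arguments.
Unset Strict Implicit.
Unset Printing Implicit Defensive.

Import Order.TTheory GRing.Theory Num.Theory.
Import numFieldNormedType.Exports.

Local Open Scope classical_set_scope.
Local Open Scope ring_scope.

(* A set-valued function on I is represented by a total F : R -> set R.  Every
   notion below looks at F only at points of the set it is relativized to, so
   the values of F outside I play no role. *)

Definition nonempty_valued_on (R : realType) (I : set R) (F : R -> set R) :
  Prop := forall x, I x -> F x !=set0.

Definition lower_semicontinuous_on (R : realType) (I : set R)
    (F : R -> set R) : Prop :=
  forall x, I x -> forall N : set R, open N -> F x `&` N !=set0 ->
  exists2 M : set R, nbhs x M &
    forall y, (M `&` I) y -> F y `&` N !=set0.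

(* The library's [dense] concerns the whole space only. *)
Definition dense_in (R : realType) (J I : set R) : Prop :=
  J `<=` I /\ I `<=` closure J.

Definition strictly_pseudomonotone_on (R : realType) (A : set R)
    (F : R -> set R) : Prop :=
  forall x y, A x -> A y -> x != y ->
  forall xs ys, F x xs -> F y ys -> 0 <= xs * (y - x) -> 0 < ys * (y - x).

Definition locally_strictly_pseudomonotone_on (R : realType) (J : set R)
    (F : R -> set R) : Prop :=
  forall x, J x -> exists U : set R,
    [/\ open U, U x & strictly_pseudomonotone_on (U `&` J) F].

(* Main.v *)
(** Only signs matter: strict pseudomonotonicity says that no nonnegative value
    at [x] coexists with a nonpositive value at some [y > x].  Given such a pair,
    let [c] be the supremum of the points of [[x, y]] where [F] has a positive
    value.  Lower semicontinuity makes this set relatively open, so [F c] has a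
    nonpositive value [w], while positive values occur at points of [J] just to
    the left of [c].  If [w = 0] then [c] lies in [J] and local strict
    pseudomonotonicity fails at [c]; if [w < 0] then, near [c], some point has
    values of both signs, hence so do all nearby points, and local strict
    pseudomonotonicity fails there. *)

Require Import Defs.
From mathcomp Require Import all_boot all_order all_algebra.
From mathcomp Require Import all_classical all_reals all_analysis.
From mathcomp Require Import lra.
Import Order.TTheory GRing.Theory Num.Theory.
Import numFieldNormedType.Exports.
Local Open Scope classical_set_scope.
Local Open Scope ring_scope.

Set Implicit Arguments.
Unset Strict Implicit.

Definition has_pos {R : realType} (F : R -> set R) (x : R) : Prop :=
  exists2 v, F x v & 0 < v.

Definition has_neg {R : realType} (F : R -> set R) (x : R) : Prop :=
  exists2 v, F x v & v < 0.

Lemma nbhs_itv (R : realType) (x : R) (M : set R) : nbhs x M ->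
  exists2 e : R, 0 < e & forall y, x - e < y < x + e -> M y.
Proof.
move=> /nbhs_ballP[e /= e0 eM]; exists e => // y xy.
by apply: eM; rewrite /ball /= distrC ltr_distl.
Qed.

(** The midpoint lies in [I], hence in the closure of [J], and the open interval is a neighborhood
    of it. *)
Lemma dense_in_itv (R : realType) (I J : set R) (p q : R) :
  is_interval I -> dense_in J I -> I p -> I q -> p < q ->
  exists2 w, J w & p < w < q.
Proof.
move=> itvI [_ IJ] Ip Iq pq.
have Im : I ((p + q) / 2) by apply: (itvI p q) => //; apply/andP; split; lra.
have nm : nbhs ((p + q) / 2) `]p, q[%classic.
  apply: open_nbhs_nbhs; split; first exact: interval_open.
  by rewrite /= in_itv /=; apply/andP; split; lra.
have [w [Jw]] := IJ _ Im _ nm.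
by rewrite /= in_itv /= => pwq; exists w.
Qed.

Lemma lsc_has_pos (R : realType) (I : set R) (F : R -> set R) (x : R) :
  lower_semicontinuous_on I F -> I x -> has_pos F x ->
  exists2 e : R, 0 < e & forall y, I y -> x - e < y < x + e -> has_pos F y.
Proof.
move=> lscF Ix [v Fv v0].
have [|M /nbhs_itv[e e0 eM] MF] := lscF x Ix [set u | 0 < u]
  (@num_normedtype.open_gt R 0).
  by exists v.
by exists e => // y Iy /eM My; have [u [Fu u0]] := MF y (conj My Iy); exists u.
Qed.

Lemma lsc_has_neg (R : realType) (I : set R) (F : R -> set R) (x : R) :
  lower_semicontinuous_on I F -> I x -> has_neg F x ->
  exists2 e : R, 0 < e & forall y, I y -> x - e < y < x + e -> has_neg F y.
Proof.
move=> lscF Ix [v Fv v0].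
have [|M /nbhs_itv[e e0 eM] MF] := lscF x Ix [set u | u < 0]
  (@num_normedtype.open_lt R 0).
  by exists v.
by exists e => // y Iy /eM My; have [u [Fu u0]] := MF y (conj My Iy); exists u.
Qed.

(** For [x < y] the positive factor [y - x] cancels; for [y < x] the condition is the contrapositive
    of the ordered one with the two points exchanged. *)
Lemma strictly_pseudomonotone_onP (R : realType) (A : set R) (F : R -> set R) :
  strictly_pseudomonotone_on A F <->
  forall x y, A x -> A y -> x < y ->
  forall xs ys, F x xs -> F y ys -> 0 <= xs -> 0 < ys.
Proof.
split=> [spF x y Ax Ay xy xs ys Fx Fy xs0|spF x y Ax Ay xNy xs ys Fx Fy].
  have xNy : x != y by rewrite lt_eqF.
  have yx0 : 0 < y - x by rewrite subr_gt0.
  by have := spF x y Ax Ay xNy xs ys Fx Fy; rewrite pmulr_lge0// pmulr_lgt0//; apply.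
move: xNy; rewrite neq_lt => /orP[xy|yx].
  have yx0 : 0 < y - x by rewrite subr_gt0.
  by rewrite pmulr_lge0// pmulr_lgt0//; apply: spF Fx Fy.
have yx0 : y - x < 0 by rewrite subr_lt0.
rewrite nmulr_lge0// nmulr_lgt0// => xs0.
by rewrite ltNge; apply/negP => ys0; have := spF y x Ay Ax yx ys xs Fy Fx ys0; lra.
Qed.

Lemma locally_strictly_pseudomonotone_itv (R : realType) (J : set R)
    (F : R -> set R) (x : R) :
  locally_strictly_pseudomonotone_on J F -> J x ->
  exists2 e : R, 0 < e & forall p q, J p -> J q ->
    x - e < p -> p < q -> q < x + e ->
    forall ps qs, F p ps -> F q qs -> 0 <= ps -> 0 < qs.
Proof.
move=> locF Jx; have [U [oU Ux /strictly_pseudomonotone_onP spF]] := locF x Jx.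
have [|e e0 eU] := @nbhs_itv R x U; first exact: open_nbhs_nbhs.
exists e => // p q Jp Jq ep pq qe ps qs.
by apply: spF; last exact: pq; split=> //; apply: eU; apply/andP; split; lra.
Qed.

Section local_to_global.
Context (R : realType) (I J : set R) (F : R -> set R)
  (I_interval : is_interval I)
  (F_nonempty : nonempty_valued_on I F)
  (F_lsc : lower_semicontinuous_on I F)
  (J_dense : dense_in J I)
  (F_loc : locally_strictly_pseudomonotone_on J F)
  (F_neq0 : forall x, (I `\` J) x -> ~ F x 0).

Let JI x : J x -> I x. Proof. by case: J_dense => + _; apply. Qed.

(** Both signs persist near [z], so two points [v < w] of [J] close together carry a positive value
    at [v] and a negative one at [w], against the local hypothesis at [w]. The point [p] provides
    room inside [I] to the left of [z]. *)
Lemma not_both_signs (p z : R) : I p -> I z -> p < z ->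
  has_pos F z -> has_neg F z -> False.
Proof.
move=> Ip Iz pz Pz Nz.
have [e e0 eP] := lsc_has_pos F_lsc Iz Pz.
have [d d0 dN] := lsc_has_neg F_lsc Iz Nz.
pose l := Num.max p (Num.max (z - e) (z - d)).
have [pl el dl] : [/\ p <= l, z - e <= l & z - d <= l].
  by split; rewrite /l !le_max lexx ?orbT.
have lz : l < z by rewrite /l !gt_max pz; apply/andP; split; lra.
have Il : I l by apply: (I_interval Ip Iz); rewrite pl ltW.
have [w Jw /andP[lw wz]] := dense_in_itv I_interval J_dense Il Iz lz.
have [f f0 spF] := locally_strictly_pseudomonotone_itv F_loc Jw.
(* The radius [f] depends on [w], so [v] is chosen after [w], within [f] of it and still to the
   right of [l]. *)
pose m := Num.max l (w - f).
have [lm fm] : l <= m /\ w - f <= m by split; rewrite /m le_max lexx ?orbT.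
have mw : m < w by rewrite /m gt_max lw; lra.
have Im : I m by apply: (I_interval Il (JI Jw)); rewrite lm ltW.
have [v Jv /andP[mv vw]] := dense_in_itv I_interval J_dense Im (JI Jw) mw.
have [vs Fv vs0] : has_pos F v by apply: eP (JI Jv) _; apply/andP; split; lra.
have [ws Fw ws0] : has_neg F w by apply: dN (JI Jw) _; apply/andP; split; lra.
suff ws1 : 0 < ws by lra.
by apply: (spF v w Jv Jw _ vw _ vs ws Fv Fw); lra.
Qed.

(** If [x] is in [J], the local hypothesis at [x] makes values at nearby points of [J] to the right
    positive. Otherwise [xs] is nonzero, hence positive, and lower semicontinuity spreads its
    sign. *)
Lemma has_pos_right (x y xs : R) : I x -> I y -> x < y -> F x xs -> 0 <= xs ->
  exists2 a, has_pos F a & x < a < y.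
Proof.
move=> Ix Iy xy Fx xs0.
suff [e e0 eP] : exists2 e : R, 0 < e &
    forall a, J a -> x < a < x + e -> has_pos F a.
  pose r := Num.min y (x + e).
  have [ry re] : r <= y /\ r <= x + e by split; rewrite /r !ge_min lexx ?orbT.
  have xr : x < r by rewrite /r lt_min xy; lra.
  have Ir : I r by apply: (I_interval Ix Iy); rewrite ry ltW.
  have [a Ja /andP[xa ar]] := dense_in_itv I_interval J_dense Ix Ir xr.
  by exists a; [apply: eP => //|]; apply/andP; split; lra.
have [Jx|nJx] := pselect (J x).
  have [e e0 spF] := locally_strictly_pseudomonotone_itv F_loc Jx.
  exists e => // a Ja /andP[xa ae].
  have [v Fv] := F_nonempty (JI Ja).
  by exists v => //; apply: (spF x a Jx Ja _ xa ae xs v Fx Fv xs0); lra.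
have Px : has_pos F x.
  exists xs => //; rewrite lt_neqAle xs0 andbT eq_sym; apply/eqP => xsE.
  by apply: (@F_neq0 x) => //; rewrite -xsE.
have [e e0 eP] := lsc_has_pos F_lsc Ix Px.
by exists e => // a /JI Ia /andP[xa ae]; apply: eP Ia _; apply/andP; split; lra.
Qed.

Lemma nonneg_left_pos_right (x y xs ys : R) : I x -> I y -> x < y ->
  F x xs -> F y ys -> 0 <= xs -> 0 < ys.
Proof.
move=> Ix Iy xy Fx Fy xs0; rewrite ltNge; apply/negP => ys0.
pose S := [set t | x < t <= y /\ has_pos F t].
have [a Pa /andP[xa ay]] := has_pos_right Ix Iy xy Fx xs0.
have Sa : S a by split=> //; rewrite xa ltW.
have supS : has_sup S.
  by split; [exists a|exists y => t [/andP[_ ty] _]].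
pose c := sup S.
have Sc t : S t -> t <= c by apply: ub_le_sup; case: supS.
have xc : x < c := lt_le_trans xa (Sc a Sa).
have cy : c <= y by apply: ge_sup; [case: supS|move=> t [/andP[]]].
have Ic : I c by apply: (I_interval Ix Iy); rewrite cy ltW.
(* A point [t] of [S] near the supremum may equal [c] or lie outside [J]; its positivity spreads to
   a point [s] of [J] strictly to its left. *)
have left e : 0 < e -> exists s, [/\ J s, c - e < s, x < s, s < c & has_pos F s].
  move=> e0; have [t [/andP[xt ty] Pt] et] := sup_adherent e0 supS.
  have tc : t <= c by apply: Sc; split=> //; rewrite xt.
  have It : I t by apply: (I_interval Ix Iy); rewrite ty ltW.
  have [d d0 dP] := lsc_has_pos F_lsc It Pt.
  pose l := Num.max x (Num.max (c - e) (t - d)).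
  have [xl el dl] : [/\ x <= l, c - e <= l & t - d <= l].
    by split; rewrite /l !le_max lexx ?orbT.
  have lt : l < t.
    by rewrite /l !gt_max xt /=; apply/andP; split; [exact: et|lra].
  have Il : I l by apply: (I_interval Ix It); rewrite xl ltW.
  have [s Js /andP[ls st]] := dense_in_itv I_interval J_dense Il It lt.
  exists s; split=> //; [lra|lra|lra|].
  by apply: dP (JI Js) _; apply/andP; split; lra.
(* If [c = y], take [ys]. If [c < y], a positive value at [c] would spread to some [r > c] in [S];
   halving [e] keeps [r] strictly inside the neighborhood. *)
have [w Fw w0] : exists2 w, F c w & w <= 0.
  move: cy; rewrite le_eqVlt => /orP[/eqP->|cy]; first by exists ys.
  have [w Fw] := F_nonempty Ic; exists w => //.
  rewrite leNgt; apply/negP => w0.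
  have [|e e0 eP] := lsc_has_pos F_lsc Ic; first by exists w.
  pose r := Num.min y (c + e / 2).
  have [ry re] : r <= y /\ r <= c + e / 2 by split; rewrite /r !ge_min lexx ?orbT.
  have cr : c < r by rewrite /r lt_min cy; lra.
  have Ir : I r by apply: (I_interval Ic Iy); rewrite ry ltW.
  suff rc : r <= c by lra.
  apply: Sc; split; first by apply/andP; split; lra.
  by apply: eP Ir _; apply/andP; split; lra.
move: w0; rewrite le_eqVlt => /orP[/eqP w0|w0].
  have Jc : J c by apply: contrapT => nJc; apply: (@F_neq0 c) => //; rewrite -w0.
  have [e e0 spF] := locally_strictly_pseudomonotone_itv F_loc Jc.
  have [s [Js es xs' sc [v Fv v0]]] := left e e0.
  suff w1 : 0 < w by lra.
  by apply: (spF s c Js Jc es sc _ v w Fv Fw); lra.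
have [|e e0 eN] := lsc_has_neg F_lsc Ic; first by exists w.
have [s [Js es xs' sc Ps]] := left e e0.
(* The point with both signs is [s]: its negative value is inherited from [c], and [x] lies to its
   left. *)
apply: (not_both_signs Ix (JI Js) xs' Ps).
by apply: eN (JI Js) _; apply/andP; split; lra.
Qed.

End local_to_global.

Theorem theorem3p5 (R : realType) (I J : set R) (F : R -> set R)
  (I_interval : is_interval I)
  (F_nonempty : nonempty_valued_on I F)
  (F_lsc : lower_semicontinuous_on I F)
  (J_dense : dense_in J I)
  (F_loc : locally_strictly_pseudomonotone_on J F)
  (F_neq0 : forall x, (I `\` J) x -> ~ F x 0) :
  strictly_pseudomonotone_on I F.
Proof.
apply/strictly_pseudomonotone_onP => x y Ix Iy xy xs ys.
exact: (nonneg_left_pos_right I_interval F_nonempty F_lsc J_dense F_loc F_neq0).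
Qed.
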